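(* Let $\mathfrak{V}$ be an exact finitely generated nontrivial linked net of vector spaces of dimension $r+1$ over a $\mathbb{Z}^n$-quiver $Q$, and let $H$ be its minimum set of generators. Then the collection of polytopes $\mathbf{P}_{\mu_v}$, $v\in H$, together with their faces, gives a polyhedral tiling of the standard simplex $\Omega_{r+1}$. In particular, $\bigcup_{v\in H}\mathbf{P}_{\mu_v}=\Omega_{r+1}$.
   Context: **$\mathbb{Z}^n$-quivers.** Let $Q$ be a quiver and $T$ a partition of its arrow set into $n+1$ nonempty parts, called arrow types. For a path $\gamma$ and $\mathfrak{a}\in T$, $\mathbf{t}_\gamma(\mathfrak{a})$ is the number of arrows of type $\mathfrak{a}$ in $\gamma$. The path $\gamma$ is admissible if $\mathbf{t}_\gamma(\mathfrak{a})=0$ for some $\mathfrak a$, and simple if $\mathbf{t}_\gamma(\mathfrak{a})\le 1$ for all $\mathfrak a$. Trivial paths are allowed. $Q$ (with $T$) is a $\mathbb{Z}^n$-quiver if: (1) exactly one arrow of each type leaves each vertex; (2) each vertex is connected to each other by an admissible path; (3) two paths $\gamma_1,\gamma_2$ leaving the same vertex arrive at the same vertex if and only if $\mathbf{t}_{\gamma_1}-\mathbf{t}_{\gamma_2}$ is a constant function on $T$. A simple non-admissible path is a circuit, called a minimal circuit. Two distinct vertices connected by a simple path are neighbors. **Linked nets.** Let $\mathbf{k}$ be a field. For a representation $\mathfrak{V}$ of $Q$ in finite-dimensional $\mathbf{k}$-vector spaces, $V_v$ is the space at vertex $v$ and $\varphi_\gamma$ is the composition of the maps along the path $\gamma$ ($\varphi_\gamma=\mathrm{id}$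 for trivial $\gamma$). $\mathfrak{V}$ is a linked net if: (1) for paths $\gamma_1,\gamma_2$ connecting the same two vertices with $\gamma_2$ admissible, $\varphi_{\gamma_1}$ is a scalar multiple of $\varphi_{\gamma_2}$; (2) $\varphi_\gamma=0$ for each minimal circuit $\gamma$; (3) if $\gamma_1,\gamma_2$ are admissible paths leaving the same vertex with no arrow type in common, then $\ker\varphi_{\gamma_1}\cap\ker\varphi_{\gamma_2}=0$. Write $\varphi^{u}_{w}$ for $\varphi_\gamma$, well defined up to nonzero scalar, with $\gamma$ any admissible path from $u$ to $w$. $\mathfrak{V}$ is exact if $\mathrm{Im}(\varphi^{u}_{w})=\ker(\varphi^{w}_{u})$ for all neighbors $u,w$. $\mathfrak V$ is of dimension $r+1$ if $\dim V_v=r+1$ for all $v$; nontrivial means the $V_v$ are nonzero. $\mathfrak{V}$ is $1$-generated by a set $H$ of vertices if for each vertex $v$ there are $w\in H$ and a path $\gamma$ from $w$ to $v$ with $\varphi_\gamma$ surjective. $\mathfrak{V}$ is finitely generated if there is a finite set $H$ of vertices such that each $V_v$ is the sum of finitely many images $\varphi_{\gamma_i}(V_{w_i})$, with $w_i\in H$ and $\gamma_i$ a path from $w_i$ to $v$; in this case it is $1$-generated by a finite set. The minimum set of generators of such an exact nontrivial $\mathfrak{V}$ is the intersection of all sets of vertices $1$-generating $\mathfrak{V}$. **Polytopes.** For $q\in\mathbf{R}^H$ and $I\subseteq H$ put $q(I)=\sum_{v\in I}q(v)$. For $v\in H$ and $I\subseteq H$ set $$\mu_v(I)=\dim\Big(\bigcap_{u\in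 H\setminus I}\ker(\varphi^v_u)\Big),\qquad \mu_v^*(I)=\dim\Big(V_v/\bigcap_{u\in I}\ker(\varphi^v_u)\Big)=\mu_v(H)-\mu_v(H\setminus I)$$ (an empty intersection is $V_v$), and $$\mathbf{P}_{\mu_v}=\{q\in\mathbf{R}^H : \mu_v(I)\le q(I)\le\mu_v^*(I)\ \text{ for all } I\subseteq H\}.$$ The standard simplex is $\Omega_{r+1}=\{q\in\mathbf{R}^H : q(v)\ge0\ \forall v\in H,\ q(H)=r+1\}$. That a collection of polytopes and their faces is a polyhedral tiling of $\Omega_{r+1}$ means that the union of the polytopes is $\Omega_{r+1}$ and that any two of the polytopes are either disjoint or intersect in a common face. *)

(* Defs.v *)
From HB Require Import structures.
From mathcomp Require Import all_boot all_order all_algebra finmap.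
From mathcomp Require Import boolp classical_sets reals.

Set Implicit Arguments.
Unset Strict Implicit.
Unset Printing Implicit Defensive.

Import GRing.Theory Num.Theory.

Local Open Scope ring_scope.

(* The partition of the arrows into n+1 nonempty parts is encoded by a
   surjective labelling of the arrows by 'I_n.+1. *)
Record typed_quiver (n : nat) := TypedQuiver {
  vertex :> choiceType;
  arrow : vertex -> vertex -> Type;
  arrow_type : forall u w : vertex, arrow u w -> 'I_n.+1;
  arrow_type_surj :
    forall a : 'I_n.+1, exists u w (e : arrow u w), arrow_type e = a
}.

Inductive qpath (n : nat) (Q : typed_quiver n) (u : Q) : Q -> Type :=
| path_nil : qpath u u
| path_rcons : forall w x : Q, qpath u w -> arrow w x -> qpath u x.

Section Paths.
Variables (n : nat) (Q : typed_quiver n).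

Fixpoint type_count (u w : Q) (g : qpath u w) (a : 'I_n.+1) : nat :=
  match g with
  | path_nil => 0%N
  | path_rcons _ _ g' e => (type_count g' a + (arrow_type e == a))%N
  end.

Definition admissible (u w : Q) (g : qpath u w) : bool :=
  [exists a, type_count g a == 0%N].

Definition simple_path (u w : Q) (g : qpath u w) : bool :=
  [forall a, (type_count g a <= 1)%N].

(* In a Z^n-quiver such a path automatically satisfies u = w. *)
Definition minimal_circuit (u w : Q) (g : qpath u w) : bool :=
  simple_path g && ~~ admissible g.

Definition neighbors (u w : Q) : Prop :=
  u <> w /\ exists g : qpath u w, simple_path g.

Record is_Zn_quiver : Prop := IsZnQuiver {
  unique_arrow : forall (u : Q) (a : 'I_n.+1),
    exists! e : {w : Q & arrow u w}, arrow_type (projT2 e) = a;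
  admissible_connected : forall u w : Q, u <> w ->
    exists g : qpath u w, admissible g;
  same_end : forall (u w1 w2 : Q) (g1 : qpath u w1) (g2 : qpath u w2),
    w1 = w2 <->
    exists c : int, forall a, (type_count g1 a)%:Z - (type_count g2 a)%:Z = c
}.

End Paths.

Record Zn_quiver (n : nat) := ZnQuiver {
  quiver_of :> typed_quiver n;
  Zn_quiverP : is_Zn_quiver quiver_of
}.

Lemma admissible_exists (n : nat) (Q : Zn_quiver n) (u w : Q) :
  exists g : qpath u w, admissible g.
Proof.
have [<-|/eqP uw] := eqVneq u w.
  by exists (path_nil u); apply/existsP; exists ord0.
exact: (admissible_connected (Zn_quiverP Q) uw).
Qed.

Definition admissible_path (n : nat) (Q : Zn_quiver n) (u w : Q) : qpath u w :=
  projT1 (cid (admissible_exists u w)).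

Record representation (k : fieldType) (n : nat) (Q : typed_quiver n) :=
  Representation {
    space :> Q -> vectType k;
    arrow_map : forall u w : Q, arrow u w -> 'Hom(space u, space w)
  }.

Fixpoint qpath_map (k : fieldType) (n : nat) (Q : typed_quiver n)
    (V : representation k Q) (u w : Q) (g : qpath u w) : 'Hom(V u, V w) :=
  match g in qpath _ x return 'Hom(V u, V x) with
  | path_nil => \1%VF
  | path_rcons _ _ g' e => (arrow_map V e \o qpath_map V g')%VF
  end.

Section LinkedNets.
Variables (k : fieldType) (n : nat) (Q : Zn_quiver n).
Variable V : representation k Q.

Record linked_net : Prop := LinkedNet {
  parallel_paths : forall (u w : Q) (g1 g2 : qpath u w), admissible g2 ->
    exists c : k, qpath_map V g1 = c *: qpath_map V g2;
  minimal_circuit_eq0 : forall (u w : Q) (g : qpath u w),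
    minimal_circuit g -> qpath_map V g = 0;
  disjoint_types : forall (u w1 w2 : Q) (g1 : qpath u w1) (g2 : qpath u w2),
    admissible g1 -> admissible g2 ->
    (forall a, type_count g1 a = 0%N \/ type_count g2 a = 0%N) ->
    (lker (qpath_map V g1) :&: lker (qpath_map V g2) = 0)%VS
}.

(* The map along some chosen admissible path; for a linked net another choice
   only changes it by a nonzero scalar, hence not its kernel or image. *)
Definition phi (u w : Q) : 'Hom(V u, V w) := qpath_map V (admissible_path u w).

Definition exact_net : Prop :=
  forall u w : Q, neighbors u w -> limg (phi u w) = lker (phi w u).

Definition pure_dim (d : nat) : Prop := forall v : Q, \dim {:V v} = d.

Definition nontrivial : Prop := forall v : Q, {:V v}%VS <> 0%VS.

Definition one_generated (G : set Q) : Prop :=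
  forall v : Q, exists w : Q, G w /\
    exists g : qpath w v, limg (qpath_map V g) = {:V v}%VS.

Definition finitely_generated : Prop :=
  exists G : {fset Q}, forall v : Q,
  exists (m : nat) (w : 'I_m -> Q) (g : forall i, qpath (w i) v),
    (forall i, w i \in G) /\
    (\sum_(i < m) limg (qpath_map V (g i)))%VS = {:V v}%VS.

Definition min_generators : set Q :=
  [set v | forall G : set Q, one_generated G -> G v]%classic.

Variable H : {fset Q}.

Definition mu (v : H) (I : {set H}) : nat :=
  \dim (\bigcap_(u in ~: I) lker (phi (val v) (val u)))%VS.

(* The dimension of the quotient of V v by the displayed intersection. *)
Definition mu_star (v : H) (I : {set H}) : nat :=
  (\dim {:V (val v)} - \dim (\bigcap_(u in I) lker (phi (val v) (val u)))%VS)%N.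

Definition mu_polytope (R : realType) (v : H) : set {ffun H -> R} :=
  [set q : {ffun H -> R} | forall I : {set H},
     (mu v I)%:R <= \sum_(u in I) q u <= (mu_star v I)%:R]%classic.

End LinkedNets.

Arguments mu_polytope {k n Q} V {H} R v.

Section Tilings.
Variables (R : realType) (E : finType).

Definition std_simplex (d : nat) : set {ffun E -> R} :=
  [set q : {ffun E -> R} | (forall v, 0 <= q v) /\ \sum_v q v = d%:R]%classic.

(* A face is the locus where a linear inequality valid on P is an equality. *)
Definition is_face (P F : set {ffun E -> R}) : Prop :=
  exists (c : {ffun E -> R}) (b : R),
    (forall q, P q -> \sum_v c v * q v <= b) /\
    F = [set q : {ffun E -> R} | P q /\ \sum_v c v * q v = b]%classic.

Definition polyhedral_tiling (J : Type) (P : J -> set {ffun E -> R})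
    (S : set {ffun E -> R}) : Prop :=
  (\bigcup_j P j)%classic = S /\
  forall i j : J, (P i `&` P j)%classic = set0 \/
    is_face (P i) (P i `&` P j)%classic /\
    is_face (P j) (P i `&` P j)%classic.

End Tilings.

Arguments std_simplex R E d : clear implicits.

(* Main.v *)
Require Import Defs.
From mathcomp Require Import all_boot all_order all_algebra finmap.
From mathcomp Require Import boolp classical_sets reals.
From mathcomp Require Import zify ring lra.

(** The polytopes are the sets of weights for which a given vertex minimizes an
energy function, and everything follows from this.

Put [N = n + 1] and let [d] be the common dimension.  A path out of a vertex
[v] is recorded by the word of its arrow types; its endpoint depends only on
the number of occurrences of each type, up to a common constant.  Let
[wker v x] be the kernel of the map along the word [x] from [v].

- Parallel admissible paths act proportionally and a path containing all types
  acts as zero ([wker_nadm]), so kernels do not depend on the order of the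
  letters ([wker_perm]).  By exactness, and since the kernels along words
  without a common type intersect trivially, the kernel along an admissible
  word depends only on the set of types occurring in it ([wker_undup]), and
  intersecting kernels amounts to intersecting these sets ([bigcap_wker]).
- By exactness, [dim (wker v (x ++ y)) = dim (wker v x) + dim (wker (v + x) y)]
  when the letters of [x ++ y] are distinct ([dim_wker_cat]).  Hence the sum of
  the kernel dimensions of the successive arrows of a path depends only on the
  number of arrows of each type ([kersum_perm]), and there is an integral
  function [degree] on the vertices that changes by [d |x| - N kersum v x]
  along a word [x] from [v] ([degree_move]).
- For a weight [q] on [H] of total mass [d] let
  [energy q v = sum_u q u * dist(v, u) + degree v].  For a word [x] with
  distinct letters, the energy changes from [v] to [v + x] by
  [N (d - dim (wker v x) - q {u | x is contained in the path from v to u})]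
  ([energy_step]).  For [v] in [H] and [q] in the simplex, this is
  nonnegative for all [x] exactly when [q] lies in the polytope of [v].
- Such a local minimum is a global one ([energy_min_global]), by a convexity
  argument: an admissible word is reached from the empty one by appending
  supports, each containing the previous ones, and each of these steps raises
  the energy at least as much as it would at the starting point.

Therefore a point [q] of the simplex lies in the polytope of [v] in [H] if and
only if [v] minimizes [energy q] over all vertices of the quiver.  Two
polytopes then meet along the locus where the difference of two energies
vanishes; as this is an affine function of [q] of constant sign on each of
them, the locus is a face of both.  For the covering, if the map along a path
from [w] to [v] is injective then the energy at [w] is at most the energy at
[v] ([energy_le_inj]); as [H] generates the net ([min_generators_generate]), a
vertex of the finite set [H] of minimal energy within [H] minimizes the energy
over all vertices. *)

(** * Words of arrow types *)

Section Words.
Set Implicit Arguments.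
Unset Strict Implicit.
Unset Printing Implicit Defensive.
Import Order.TTheory GRing.Theory Num.Theory.
Variables (n : nat) (Q : Zn_quiver n).
Local Notation T := 'I_n.+1.
Implicit Types (u v w : Q) (a b : T) (s x y z : seq T).

Lemma arrow_from u a :
  exists e : {w : Q & arrow u w}, arrow_type (projT2 e) = a.
Proof. by have [e [ea _]] := unique_arrow (Zn_quiverP Q) u a; exists e. Qed.

(** The end of the unique arrow of type [a] leaving [u]. *)
Definition nxt u a : Q := projT1 (projT1 (cid (arrow_from u a))).

Definition arr u a : arrow u (nxt u a) := projT2 (projT1 (cid (arrow_from u a))).

Lemma arr_type u a : arrow_type (arr u a) = a.
Proof. exact: projT2 (cid (arrow_from u a)). Qed.

(** The end of the path leaving [u] whose successive arrow types are the letters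
of [s]. *)
Fixpoint move u s : Q := if s is a :: s' then move (nxt u a) s' else u.

Lemma move_cat u s1 s2 : move u (s1 ++ s2) = move (move u s1) s2.
Proof. by elim: s1 u => //= a s1 IH u; rewrite IH. Qed.

(** Concatenation of paths. *)
Fixpoint qcat u v w (g : qpath u v) (h : qpath v w) : qpath u w :=
  match h in qpath _ x return qpath u x with
  | path_nil => g
  | path_rcons _ _ h' e => path_rcons (qcat g h') e
  end.

Lemma type_count_cat u v w (g : qpath u v) (h : qpath v w) a :
  type_count (qcat g h) a = (type_count g a + type_count h a)%N.
Proof. by elim: h => /= [|x y h -> e]; rewrite ?addn0 ?addnA. Qed.

(** The path leaving [u] whose successive arrow types are the letters of [s]. *)
Fixpoint wpath u s : qpath u (move u s) :=
  match s return qpath u (move u s) with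
  | [::] => path_nil u
  | a :: s' => qcat (path_rcons (path_nil u) (arr u a)) (wpath (nxt u a) s')
  end.

Lemma type_count_wpath u s a : type_count (wpath u s) a = count_mem a s.
Proof.
elim: s u => //= b s IH u.
by rewrite type_count_cat IH /= arr_type add0n.
Qed.

(** The word of arrow types of a path. *)
Fixpoint word u w (g : qpath u w) : seq T :=
  if g is path_rcons _ _ g' e then rcons (word g') (arrow_type e) else [::].

Lemma count_word u w (g : qpath u w) a : count_mem a (word g) = type_count g a.
Proof.
by elim: g => //= x y g IH e; rewrite -cats1 count_cat IH /= addn0.
Qed.

Lemma move_word u w (g : qpath u w) : move u (word g) = w.
Proof.
apply/(same_end (Zn_quiverP Q) (wpath u (word g)) g); exists 0%R => a.
by rewrite type_count_wpath count_word subrr.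
Qed.

Lemma move_eq u s1 s2 : move u s1 = move u s2 <->
  exists c : int, forall a, ((count_mem a s1)%:Z - (count_mem a s2)%:Z = c)%R.
Proof.
rewrite (same_end (Zn_quiverP Q) (wpath u s1) (wpath u s2)).
by split=> -[c cE]; exists c => a; move: (cE a); rewrite !type_count_wpath.
Qed.

Lemma move_perm u s1 s2 : perm_eq s1 s2 -> move u s1 = move u s2.
Proof.
by move/permP=> E; apply/move_eq; exists 0%R => a; rewrite E subrr.
Qed.

(** A word is admissible when some type does not occur in it. *)
Definition adm s := [exists a, a \notin s].

Lemma adm_sub s1 s2 : {subset s1 <= s2} -> adm s2 -> adm s1.
Proof.
by move=> s12 /existsP[a as2]; apply/existsP; exists a; apply: contra as2 => /s12.
Qed.

Lemma adm_nil : adm [::]. Proof. by apply/existsP; exists ord0. Qed.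

Lemma mem_nadm s a : ~~ adm s -> a \in s.
Proof. by move/existsPn/(_ a); rewrite negbK. Qed.

Lemma admissible_count u w (g : qpath u w) s :
  (forall a, type_count g a = count_mem a s) -> admissible g = adm s.
Proof.
move=> E; apply: eq_existsb => a; rewrite E.
by rewrite -has_pred1 has_count -eqn0Ngt.
Qed.

Lemma admissible_wpath u s : admissible (wpath u s) = adm s.
Proof. by apply: admissible_count => a; rewrite type_count_wpath. Qed.

Lemma admissible_word u w (g : qpath u w) : admissible g = adm (word g).
Proof. by apply: admissible_count => a; rewrite count_word. Qed.

(** A word in which every type occurs exactly [c] times; it leads from any vertex
back to itself. *)
Definition loops c : seq T := flatten (nseq c (enum 'I_n.+1)).

Lemma count_loops c a : count_mem a (loops c) = c.
Proof.
elim: c => //= c IH; rewrite /loops /= count_cat -/(loops c) IH.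
by rewrite count_uniq_mem ?enum_uniq // mem_enum.
Qed.

Lemma size_loops c : size (loops c) = (c * n.+1)%N.
Proof.
by elim: c => //= c IH; rewrite /loops /= size_cat -/(loops c) IH size_enum_ord mulSn.
Qed.

Lemma move_loops u c : move u (loops c) = u.
Proof.
by apply/(move_eq u _ [::]); exists (Posz c) => a; rewrite count_loops subr0.
Qed.

Lemma move_perm_loops u s z : adm z -> move u s = move u z ->
  exists c, perm_eq s (z ++ loops c).
Proof.
move=> /existsP[a az] /move_eq[c cE].
(* The type missing from [z] shows that [c] is a natural number. *)
have c0 : (0 <= c)%R by rewrite -(cE a) (count_memPn az) subr0.
case: c c0 cE => // c _ cE; exists c; apply/allP => b _ /=; apply/eqP.
rewrite count_cat count_loops; move: (cE b) => /=.
by set p := count _ s; set q := count _ z; lia.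
Qed.

Lemma move_perm_adm u s z : adm s -> adm z -> move u s = move u z ->
  perm_eq s z.
Proof.
move=> sA zA E; have [[|c]] := move_perm_loops zA E; first by rewrite cats0.
move=> /permP p; case/existsP: sA => a; rewrite -has_pred1 has_count.
by rewrite p count_cat count_loops addnS.
Qed.

(** The word of an admissible path from [u] to [w]; it is unique up to the order of
its letters ([perm_wd]). *)
Definition wd u w := word (admissible_path u w).

Lemma move_wd u w : move u (wd u w) = w. Proof. exact: move_word. Qed.

Lemma wd_adm u w : adm (wd u w).
Proof.
by rewrite -admissible_word; exact: projT2 (cid (admissible_exists u w)).
Qed.

Lemma perm_wd u w s : adm s -> move u s = w -> perm_eq s (wd u w).
Proof.
by move=> sA E; apply: (@move_perm_adm u) => //; rewrite ?wd_adm // move_wd.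
Qed.

(** The length of an admissible path from [u] to [w], which is the length of a
shortest path; it is not symmetric. *)
Definition dist u w := size (wd u w).

Lemma dist_le u s : dist u (move u s) <= size s.
Proof.
have [||c p] := @move_perm_loops u s (wd u (move u s)); rewrite ?wd_adm ?move_wd //.
by rewrite (perm_size p) size_cat leq_addr.
Qed.

Lemma distE u s w : adm s -> move u s = w -> dist u w = size s.
Proof. by move=> sA /(perm_wd sA)/perm_size. Qed.

(** The types that do not occur in [s]. *)
Definition compl s : seq T := [seq a <- enum 'I_n.+1 | a \notin s].

Lemma mem_compl s a : (a \in compl s) = (a \notin s).
Proof. by rewrite mem_filter mem_enum andbT. Qed.

Lemma compl_uniq s : uniq (compl s).
Proof. by rewrite filter_uniq ?enum_uniq. Qed.

Lemma perm_compl s : uniq s -> perm_eq (s ++ compl s) (enum 'I_n.+1).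
Proof.
move=> us; apply: uniq_perm; rewrite ?enum_uniq //.
  rewrite cat_uniq us compl_uniq andbT /=.
  by apply/hasPn => a; rewrite mem_compl.
by move=> a; rewrite mem_cat mem_compl mem_enum orbN.
Qed.

Lemma move_compl u s : uniq s -> move (move u s) (compl s) = u.
Proof.
move=> us; rewrite -move_cat (move_perm _ (perm_compl us)).
by have := move_loops u 1; rewrite /loops /= cats0.
Qed.

Lemma sub_perm x z : uniq x -> {subset x <= z} ->
  exists2 y, perm_eq z (x ++ y) & {subset y <= z}.
Proof.
elim: x z => [|a x IH] z /=; first by exists z.
case/andP=> ax ux sxz; have az : a \in z by apply: sxz; rewrite inE eqxx.
have [b bx|y p _] := IH (rem a z) ux.
  have bz : b \in z by apply: sxz; rewrite inE bx orbT.
  move: bz; rewrite (perm_mem (perm_to_rem az)) inE => /orP[/eqP ba|//].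
  by rewrite ba (negPf ax) in bx.
have p' : perm_eq z (a :: x ++ y).
  by apply: perm_trans (perm_to_rem az) _; rewrite perm_cons.
exists y => // b yb; rewrite (perm_mem p') inE mem_cat yb !orbT //.
Qed.

Lemma perm_undup_cat s : exists2 y, perm_eq s (undup s ++ y) & {subset y <= s}.
Proof. by apply: sub_perm (undup_uniq s) _ => a; rewrite mem_undup. Qed.

Lemma dist_step_sub v u x : uniq x -> {subset x <= wd v u} ->
  dist v u = (size x + dist (move v x) u)%N.
Proof.
move=> ux sx; have [y p sy] := sub_perm ux sx.
rewrite {1}/dist (perm_size p) size_cat; congr addn.
by apply/esym/distE; rewrite ?(adm_sub sy) ?wd_adm // -move_cat -(move_perm _ p) move_wd.
Qed.

(** If some letter of [x] does not occur in the admissible word from [v] to [u],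
the way from [v + x] to [u] goes through the complement of [x] first. *)
Lemma dist_step_nsub v u x : uniq x -> ~~ all (mem (wd v u)) x ->
  (dist (move v x) u + size x = dist v u + n.+1)%N.
Proof.
move=> ux /allPn[a ax /= awd].
have sA : adm (compl x ++ wd v u).
  by apply/existsP; exists a; rewrite mem_cat mem_compl ax.
have sE : move (move v x) (compl x ++ wd v u) = u.
  by rewrite move_cat move_compl // move_wd.
have := perm_size (perm_compl ux).
rewrite (distE sA sE) !size_cat size_enum_ord -/(dist v u).
by set p := size x; set q := size (compl x); lia.
Qed.

End Words.

(** * Kernels of the maps along words *)

Section Kernels.
Set Implicit Arguments.
Unset Strict Implicit.
Unset Printing Implicit Defensive.
Import Order.TTheory GRing.Theory Num.Theory.
Local Open Scope ring_scope.
Variables (k : fieldType) (n : nat) (Q : Zn_quiver n) (V : representation k Q).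
Local Notation T := 'I_n.+1.
Implicit Types (u v w : Q) (a b : T) (s x y z : seq T).

Lemma qpath_map_cat u v w (g : qpath u v) (h : qpath v w) :
  qpath_map V (qcat g h) = (qpath_map V h \o qpath_map V g)%VF.
Proof.
by elim: h => /= [|x y h -> e]; rewrite ?comp_lfun1l ?comp_lfunA.
Qed.

(** The map along the word [s] from [v]. *)
Definition wmap v s : 'Hom(V v, V (move v s)) := qpath_map V (wpath v s).

(** The kernel of the map along the word [s] from [v]. *)
Definition wker v s : {vspace V v} := lker (wmap v s).

Lemma wmap_nil v (e : V v) : wmap v [::] e = e.
Proof. by rewrite /wmap /= id_lfunE. Qed.

Lemma wmap_cons v a s (e : V v) :
  wmap v (a :: s) e = wmap (nxt v a) s (arrow_map V (arr v a) e).
Proof. by rewrite /wmap /= qpath_map_cat /= comp_lfun1r comp_lfunE. Qed.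

Lemma mem_wker v s (e : V v) : (e \in wker v s) = (wmap v s e == 0).
Proof. exact: memv_ker. Qed.

Lemma mem_wker_cat v s1 s2 (e : V v) :
  (e \in wker v (s1 ++ s2)) = (wmap v s1 e \in wker (move v s1) s2).
Proof.
elim: s1 v e => /= [|a s1 IH] v e; first by rewrite wmap_nil.
by rewrite wmap_cons -IH !mem_wker wmap_cons.
Qed.

Lemma wker_nil v : wker v [::] = 0%VS.
Proof. by apply/eqP; rewrite -subv0; apply/subvP => e; rewrite mem_wker wmap_nil memv0. Qed.

Lemma wker_catl v s1 s2 : (wker v s1 <= wker v (s1 ++ s2))%VS.
Proof.
apply/subvP => e; rewrite mem_wker_cat mem_wker => /eqP ->; exact: mem0v.
Qed.

Hypothesis V_linked : linked_net V.

(** Parallel admissible paths induce the same map up to a nonzero scalar. *)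
Lemma parallel_neq0 u w (g1 g2 : qpath u w) : admissible g1 -> admissible g2 ->
  exists2 c : k, c != 0 & qpath_map V g1 = c *: qpath_map V g2.
Proof.
move=> A1 A2; have [c E] := parallel_paths V_linked g1 A2.
have [d E'] := parallel_paths V_linked g2 A1.
have [c0|c0] := eqVneq c 0; last by exists c.
by exists 1; rewrite ?oner_neq0 // E' E c0 !scale0r !scaler0.
Qed.

Lemma parallel_lker u w (g1 g2 : qpath u w) : admissible g1 -> admissible g2 ->
  lker (qpath_map V g1) = lker (qpath_map V g2).
Proof.
move=> A1 A2; have [c c0 ->] := parallel_neq0 A1 A2.
by apply/vspaceP => e; rewrite !memv_ker scale_lfunE scaler_eq0 (negPf c0).
Qed.

Lemma parallel_limg u w (g1 g2 : qpath u w) : admissible g1 -> admissible g2 ->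
  limg (qpath_map V g1) = limg (qpath_map V g2).
Proof.
have sub (h1 h2 : qpath u w) : admissible h1 -> admissible h2 ->
    (limg (qpath_map V h1) <= limg (qpath_map V h2))%VS.
  move=> A1 A2; have [c _ ->] := parallel_neq0 A1 A2.
  apply/subvP => _ /memv_imgP[e _ ->]; rewrite scale_lfunE.
  by rewrite memvZ // memv_img // memvf.
by move=> A1 A2; apply/eqP; rewrite eqEsubv !sub.
Qed.

Lemma wker_phi v s w : adm s -> move v s = w -> wker v s = lker (phi V v w).
Proof.
move=> sA <-; apply: parallel_lker; first by rewrite admissible_wpath.
exact: projT2 (cid (admissible_exists _ _)).
Qed.

Lemma wker_perm_adm v s s' : adm s -> perm_eq s s' -> wker v s = wker v s'.
Proof.
move=> sA p; have s'A : adm s' by apply: adm_sub sA => a; rewrite (perm_mem p).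
by rewrite (wker_phi s'A erefl) -(move_perm _ p) -(wker_phi sA erefl).
Qed.

Lemma wker_perm_catl v s s' s1 : adm s -> perm_eq s s' ->
  wker v (s ++ s1) = wker v (s' ++ s1).
Proof.
move=> sA p; apply/vspaceP => e; rewrite (mem_wker_cat s s1) (mem_wker_cat s' s1).
rewrite [in RHS]/wmap; have : admissible (wpath v s').
  by rewrite admissible_wpath; apply: adm_sub sA => a; rewrite (perm_mem p).
move: (wpath v s'); rewrite -(move_perm v p) => g gA.
have [|c c0 E] := parallel_neq0 _ gA (g1 := wpath v s).
  by rewrite admissible_wpath.
by rewrite /wmap E scale_lfunE !mem_wker linearZ scaler_eq0 (negPf c0).
Qed.

Lemma wker_uniq_nadm v s : uniq s -> ~~ adm s -> wker v s = {:V v}%VS.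
Proof.
move=> us sN; apply/eqP; rewrite eqEsubv subvf; apply/subvP => e _.
rewrite mem_wker /wmap (minimal_circuit_eq0 V_linked) ?lfunE //.
rewrite /minimal_circuit admissible_wpath sN andbT.
by apply/forallP => a; rewrite type_count_wpath count_uniq_mem // leq_b1.
Qed.

(** The map along a path containing all types is zero, even when the path is not a
minimal circuit. *)
Lemma wker_nadm v s : ~~ adm s -> wker v s = {:V v}%VS.
Proof.
elim/last_ind: s v => [|s b IH] v sbN; first by rewrite adm_nil in sbN.
apply/eqP; rewrite eqEsubv subvf -cats1 /=.
have [sA|sN] := boolP (adm s); last by rewrite -(IH v sN) wker_catl.
(* The missing type [b] completes the distinct letters of [s], moved to the end,
   to a minimal circuit. *)
have [y p _] := perm_undup_cat s; rewrite perm_sym perm_catC perm_sym in p.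
rewrite (wker_perm_catl _ _ sA p) -catA; apply/subvP => e _.
rewrite mem_wker_cat wker_uniq_nadm ?memvf //.
  rewrite cat_uniq undup_uniq /= andbT orbF mem_undup.
  case/existsP: sA => a asN.
  have := mem_nadm a sbN; rewrite mem_rcons inE (negPf asN) orbF => /eqP <-.
  exact: asN.
apply: contra sbN; apply: adm_sub => a.
by rewrite mem_rcons mem_cat mem_undup !inE orbC.
Qed.

Lemma wker_perm v s s' : perm_eq s s' -> wker v s = wker v s'.
Proof.
move=> p; have [sA|sN] := boolP (adm s); first exact: wker_perm_adm.
rewrite !wker_nadm //; apply: contra sN; apply: adm_sub => a.
by rewrite (perm_mem p).
Qed.

Lemma wker_cat v s1 s2 : wker v (s1 ++ s2) = (wmap v s1 @^-1: wker (move v s1) s2)%VS.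
Proof. by apply/vspaceP => e; rewrite mem_wker_cat -memv_preim. Qed.

Lemma disjoint_wker v s1 s2 : adm s1 -> adm s2 -> ~~ has (mem s1) s2 ->
  (wker v s1 :&: wker v s2 = 0)%VS.
Proof.
move=> A1 A2 /hasPn d; apply: (disjoint_types V_linked); rewrite ?admissible_wpath //.
move=> a; rewrite !type_count_wpath.
have [a2|/count_memPn] := boolP (a \in s2); last by right.
by left; apply/count_memPn; exact: d.
Qed.

Hypothesis V_exact : exact_net V.

(** Exactness: the image of the map along a word with distinct letters is the
kernel of the way back, which uses the complementary types. *)
Lemma limg_wmap v s : uniq s -> limg (wmap v s) = wker (move v s) (compl s).
Proof.
move=> us; have [sA|sN] := boolP (adm s); last first.
  have -> : compl s = [::].
    by rewrite -(filter_pred0 (enum 'I_n.+1)); apply: eq_filter => a; rewrite mem_nadm.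
  rewrite wker_nil; apply/eqP; rewrite -subv0; apply/subvP => _ /memv_imgP[e _ ->].
  by rewrite memv0 -mem_wker wker_nadm // memvf.
case: s us sA => [|a s] us sA.
  rewrite [RHS]wker_nadm; last by apply/existsPn => a; rewrite mem_compl.
  by rewrite /wmap lim1g.
set s' := a :: s in us sA *.
have s'N : v <> move v s'.
  move=> E; have /move_eq[c cE] : move v s' = move v [::] by [].
  case/existsP: sA => b bs; have := cE b; rewrite (count_memPn bs) /= subr0 => c0.
  by have := cE a; rewrite -c0 /= eqxx.
have <- : limg (phi V v (move v s')) = limg (wmap v s').
  apply: parallel_limg; last by rewrite admissible_wpath.
  exact: projT2 (cid (admissible_exists _ _)).
rewrite V_exact; last first.
  split=> //; exists (wpath v s'); apply/forallP => b.
  by rewrite type_count_wpath count_uniq_mem // leq_b1.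
rewrite (@wker_phi _ (compl s') v) ?move_compl //.
by apply/existsP; exists a; rewrite mem_compl negbK inE eqxx.
Qed.

(** The kernel of the second map is contained in the image of the first one, since
the types of [s2] are among those of the way back along [s1]. *)
Lemma dim_wker_cat v s1 s2 : uniq (s1 ++ s2) ->
  \dim (wker v (s1 ++ s2)) = (\dim (wker v s1) + \dim (wker (move v s1) s2))%N.
Proof.
move=> u12; have [u1 d u2] : [/\ uniq s1, ~~ has (mem s1) s2 & uniq s2].
  by move: u12; rewrite cat_uniq => /and3P[].
have sub : (wker (move v s1) s2 <= limg (wmap v s1))%VS.
  have s2c : {subset s2 <= compl s1}.
    by move=> a a2; rewrite mem_compl; exact: (hasPn d).
  have [y p _] := sub_perm u2 s2c.
  by rewrite limg_wmap // (wker_perm _ p) wker_catl.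
have := limg_ker_dim (wmap v s1) (wker v (s1 ++ s2)).
have -> : (wker v (s1 ++ s2) :&: lker (wmap v s1) = wker v s1)%VS.
  by apply/capv_idPr; exact: wker_catl.
by rewrite {1}wker_cat lpreimK.
Qed.

(** The kernel depends only on the set of types: the repeated letters of [s] act
injectively on the image of the map along [undup s], because they share no type
with the complement of [undup s], along which that image is a kernel. *)
Lemma wker_undup v s : adm s -> wker v s = wker v (undup s).
Proof.
move=> sA; have [y p sy] := perm_undup_cat s.
apply/eqP; rewrite (wker_perm v p) eqEsubv (wker_catl v (undup s) y) andbT.
apply/subvP => e; rewrite mem_wker_cat => ey; rewrite mem_wker -memv0.
have [s0|s0] := eqVneq s [::].
  by move: p ey; rewrite s0 /= => /perm_size/esym/size0nil ->; rewrite wker_nil.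
(* The image of [e] lies both in the kernel along [y] and in the image of the map
   along [undup s], which is the kernel along the complement. *)
rewrite -(@disjoint_wker _ y (compl (undup s))).
- rewrite memv_cap ey -limg_wmap ?undup_uniq // memv_img // memvf //.
- exact: adm_sub sA.
- case: s s0 {p sA sy ey} => // a s _.
  by apply/existsP; exists a; rewrite mem_compl mem_undup negbK inE eqxx.
by apply/hasPn => a; rewrite mem_compl mem_undup; apply: contra => /sy.
Qed.

End Kernels.

(** * Intersections of kernels and the degree *)

Section Potential.
Set Implicit Arguments.
Unset Strict Implicit.
Unset Printing Implicit Defensive.
Import Order.TTheory GRing.Theory Num.Theory.
Local Open Scope ring_scope.
Variables (k : fieldType) (n : nat) (Q : Zn_quiver n) (V : representation k Q).
Local Notation T := 'I_n.+1.
Implicit Types (u v w : Q) (a b : T) (s x y z : seq T).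
Hypothesis V_linked : linked_net V.
Hypothesis V_exact : exact_net V.

(** Intersecting kernels amounts to intersecting sets of types.  The hypothesis says
that the second set does not contain all types. *)
Lemma wker_cap v (P P' : pred T) (b : T) : ~~ P' b ->
  (wker V v (filter P (enum 'I_n.+1)) :&: wker V v (filter P' (enum 'I_n.+1)) <=
   wker V v (filter (predI P P') (enum 'I_n.+1)))%VS.
Proof.
set e := enum _ => P'b.
have perm (S S' : pred T) (t : seq T) :
    perm_eq (filter S t) (filter (predI S S') t ++ filter (predD S S') t).
  rewrite -(perm_filterC S' (filter S t)) -!filter_predI.
  by rewrite (@eq_filter _ (predI S S') (predI S' S)) // => a /=; rewrite andbC.
(* If [predD P P'] contains all types then [P'] contains none. *)
have [A1|N1] := boolP (adm (filter (predD P P') e)); last first.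
  have P'0 : P' =1 pred0.
    by move=> a; have := mem_nadm a N1; rewrite mem_filter /= => /andP[/andP[/negPf]].
  rewrite (eq_filter P'0) filter_pred0 capvC; apply: subv_trans (capvSl _ _) _.
  by rewrite wker_nil sub0v.
have A2 : adm (filter (predD P' P) e).
  by apply/existsP; exists b; rewrite mem_filter /= (negPf P'b) andbF.
rewrite (wker_perm V_linked v (perm P P' e)) (wker_perm V_linked v (perm P' P e)).
have -> : filter (predI P' P) e = filter (predI P P') e.
  by apply: eq_filter => a /=; rewrite andbC.
set z := filter (predI P P') e; apply/subvP => x.
rewrite memv_cap (mem_wker_cat z (filter (predD P P') e)).
rewrite (mem_wker_cat z (filter (predD P' P) e)).
move=> /andP[x1 x2]; rewrite mem_wker -memv0.
rewrite -(disjoint_wker V_linked (move v z) A1 A2) ?memv_cap ?x1 //.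
apply/hasPn => a; rewrite !mem_filter => /andP[/andP[aP _] _].
by apply/negP => /=; rewrite mem_filter => /andP[/andP[_ aP'] _]; case/negP: aP.
Qed.

(** A common kernel element of the maps from [v] to the vertices of [J] is killed by
the map along the types that occur on the way to each of them. *)
Lemma bigcap_wker v (J : seq Q) :
  (\bigcap_(u <- J) lker (phi V v u) <=
   wker V v [seq a <- enum 'I_n.+1 | all (fun u => a \in wd v u) J])%VS.
Proof.
elim: J => [|u J IH].
  rewrite big_nil (@wker_nadm _ _ _ _ V_linked) //.
  by apply/existsPn => a; rewrite negbK mem_filter mem_enum.
rewrite big_cons; have /existsP[b bu] := wd_adm v u.
apply: subv_trans (capvS (subvv _) IH) _; rewrite capvC.
rewrite -(wker_phi V_linked (wd_adm v u) (move_wd v u)).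
rewrite (wker_undup V_linked V_exact v (wd_adm v u)).
have p : perm_eq (undup (wd v u)) (filter (mem (wd v u)) (enum 'I_n.+1)).
  apply: uniq_perm; [exact: undup_uniq|exact: filter_uniq (enum_uniq _)|].
  by move=> a; rewrite mem_undup mem_filter mem_enum andbT.
rewrite (wker_perm V_linked v p); apply: subv_trans (wker_cap _ _ bu) _.
rewrite (@eq_filter _ _ (fun a => all (fun u => a \in wd v u) (u :: J))) ?subvv //.
by move=> a /=; rewrite andbC.
Qed.

(** The sum of the dimensions of the kernels of the successive arrows of the path. *)
Fixpoint kersum v s : nat :=
  if s is a :: s' then (\dim (wker V v [:: a]) + kersum (nxt v a) s')%N else 0%N.

Lemma kersum_cat v s1 s2 :
  kersum v (s1 ++ s2) = (kersum v s1 + kersum (move v s1) s2)%N.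
Proof. by elim: s1 v => //= a s1 IH v; rewrite IH addnA. Qed.

(** For distinct letters the kernel dimensions of the arrows add up to that of the
whole path. *)
Lemma kersum_uniq v s : uniq s -> kersum v s = \dim (wker V v s).
Proof.
elim: s v => [|a s IH] v us; first by rewrite wker_nil dimv0.
rewrite -cat1s (dim_wker_cat V_linked V_exact) //= -IH //.
by case/andP: us.
Qed.

Lemma kersum_perm v s s' : perm_eq s s' -> kersum v s = kersum v s'.
Proof.
(* Two neighboring distinct letters may be exchanged, as the two orders compute
   the kernel dimension of the same two-letter word. *)
have swap w a p q : kersum w (p ++ a :: q) = kersum w (a :: p ++ q).
  elim: p w => //= b p IH w; rewrite IH /= !addnA.
  have -> : nxt (nxt w b) a = nxt (nxt w a) b.
    by apply: (@move_perm _ _ w [:: b; a] [:: a; b]);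
      rewrite -[_ :: _]/([::b] ++ [::a]) perm_catC.
  congr addn; have [->//|ab] := eqVneq a b.
  have E c d : c != d -> (\dim (wker V w [:: c]) + \dim (wker V (nxt w c) [:: d]))%N =
      \dim (wker V w [:: c; d]).
    by move=> cd; rewrite -[RHS]kersum_uniq /= ?addn0 // inE cd.
  rewrite !E // 1?eq_sym //; congr (\dim _).
  by apply: wker_perm => //; rewrite -[_ :: _]/([::b] ++ [::a]) perm_catC.
elim: s v s' => [|a s IH] v s' p.
  by move: p; rewrite perm_sym => /perm_size/size0nil ->.
have as' : a \in s' by rewrite -(perm_mem p) inE eqxx.
case/splitPr: as' p => p q ps; rewrite swap /= (IH _ (p ++ q)) //.
by rewrite -(perm_cons a) (perm_trans ps) // -cat1s perm_catCA.
Qed.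

Variable d : nat.
Hypothesis V_dim : pure_dim V d.

Lemma kersum_loops v c : kersum v (loops n c) = (c * d)%N.
Proof.
elim: c v => //= c IH v.
rewrite /loops /= kersum_cat -/(loops n c) IH mulSn; congr addn.
rewrite kersum_uniq ?enum_uniq // wker_nadm //.
by apply/existsPn => a; rewrite negbK mem_enum.
Qed.

Variable o : Q.
(** A potential on the vertices, normalized to vanish at the base vertex [o]. *)
Definition degree v : int := (d * dist o v)%:Z - (n.+1 * kersum o (wd o v))%:Z.

(** The degree is well defined along arbitrary words because a full circuit has
length [n.+1] and total kernel dimension [d]. *)
Lemma degree_move v s :
  degree (move v s) = degree v + (d * size s)%:Z - (n.+1 * kersum v s)%:Z.
Proof.
have [||c p] := @move_perm_loops _ _ o (wd o v ++ s) (wd o (move v s)).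
- exact: wd_adm.
- by rewrite move_cat !move_wd.
have := perm_size p; rewrite !size_cat size_loops -!/(dist _ _) => D.
have := kersum_perm o p; rewrite !kersum_cat kersum_loops !move_wd => E.
have/(congr1 (muln d)) := D; have/(congr1 (muln n.+1)) := E.
rewrite /degree.
by move: (dist _ _) (dist _ _) (size s) (kersum _ _) (kersum _ _) (kersum _ _); lia.
Qed.

Lemma dim_wker_le v s : (\dim (wker V v s) <= d)%N.
Proof. by rewrite -(V_dim v) dimvS ?subvf. Qed.

Lemma dim_limg_wmap v s : (\dim (limg (wmap V v s)) = d - \dim (wker V v s))%N.
Proof. by rewrite -(V_dim v) -(limg_ker_dim (wmap V v s) fullv) capfv addKn. Qed.

(** The rank of the map along [x] at [move v s] is at least that of the composite
map along [s ++ x] at [v]. *)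
Lemma dim_wker_move v s x : 
  (\dim (wker V (move v s) x) <= \dim (wker V v (s ++ x)))%N.
Proof.
(* The kernel of the composite is an extension of the part of the second kernel
   inside the image by the first kernel. *)
have -> : \dim (wker V v (s ++ x)) =
    (\dim (wker V v s) + \dim (wker V (move v s) x :&: limg (wmap V v s)))%N.
  rewrite wker_cat -lpreim_cap_limg -[LHS](limg_ker_dim (wmap V v s)).
  rewrite lpreimK ?capvSr //; congr addn; congr (\dim _).
  by apply/capv_idPr; rewrite -lpreim0 lpreimS ?sub0v.
have := dimv_sum_cap (wker V (move v s) x) (limg (wmap V v s)).
have := dimvS (subvf (wker V (move v s) x + limg (wmap V v s))%VS).
have := dim_limg_wmap v s; have := dim_wker_le v s; rewrite V_dim.
move: (\dim _) (\dim _) (\dim _) (\dim _) (\dim _); lia.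
Qed.

Lemma kersum0 v s : wker V v s = 0%VS -> kersum v s = 0%N.
Proof.
elim: s v => //= a s IH v K0.
have Ka : wker V v [:: a] = 0%VS.
  by apply/eqP; rewrite -subv0 -K0 -cat1s wker_catl.
rewrite Ka dimv0 IH //; apply/eqP; rewrite -dimv_eq0 -leqn0.
by have := dim_wker_move v [:: a] s; rewrite cat1s K0 dimv0.
Qed.

End Potential.

(** * Every path is the path of a word *)

Section PathsAsWords.
Set Implicit Arguments.
Unset Strict Implicit.
Unset Printing Implicit Defensive.
Variables (n : nat) (Q : Zn_quiver n).
Local Notation T := 'I_n.+1.
Implicit Types (u v w : Q) (a b : T) (s : seq T).

Lemma arrow_uniq w x (e : arrow w x) :
  existT _ x e = existT _ (nxt w (arrow_type e)) (arr w (arrow_type e)).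
Proof.
have [h [_ hE]] := unique_arrow (Zn_quiverP Q) w (arrow_type e).
rewrite -(hE (existT _ x e) erefl); apply: hE; exact: arr_type.
Qed.

Lemma wpath_rcons u s a : existT (qpath u) _ (wpath u (rcons s a)) =
  existT (qpath u) _ (path_rcons (wpath u s) (arr (move u s) a)).
Proof.
elim: s u => //= b s IH u.
pose F (p : {w : Q & qpath (nxt u b) w}) : {w : Q & qpath u w} :=
  existT _ _ (qcat (path_rcons (path_nil u) (arr u b)) (projT2 p)).
exact: (congr1 F (IH _)).
Qed.

Lemma qpath_word u w (g : qpath u w) :
  existT (qpath u) w g = existT (qpath u) _ (wpath u (word g)).
Proof.
elim: g => //= w' x g IH e; rewrite wpath_rcons.
pose F (p : {y : Q & arrow w' y}) : {y : Q & qpath u y} :=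
  existT _ _ (path_rcons g (projT2 p)).
pose G (p : {y : Q & qpath u y}) : {y : Q & qpath u y} :=
  existT _ _ (path_rcons (projT2 p) (arr (projT1 p) (arrow_type e))).
exact: etrans (congr1 F (arrow_uniq e)) (congr1 G IH).
Qed.

(** To prove a property of all paths leaving [u] it suffices to prove it for the
paths of words. *)
Lemma qpath_wpath u (P : forall w, qpath u w -> Prop) :
  (forall s, P _ (wpath u s)) -> forall w g, P w g.
Proof.
move=> PW w g; rewrite -[w]/(projT1 (existT (qpath u) w g)).
rewrite -[X in P _ X]/(projT2 (existT (qpath u) w g)) qpath_word; exact: PW.
Qed.

End PathsAsWords.

(** * The minimum set of generators generates *)

Section Generation.
Set Implicit Arguments.
Unset Strict Implicit.
Unset Printing Implicit Defensive.
Import Order.TTheory GRing.Theory Num.Theory.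
Local Open Scope ring_scope.
Variables (k : fieldType) (n : nat) (Q : Zn_quiver n) (V : representation k Q).
Local Notation T := 'I_n.+1.
Implicit Types (u v w : Q) (a b : T) (s : seq T).
Hypothesis V_linked : linked_net V.
Variable d : nat.
Hypothesis V_dim : pure_dim V d.

Lemma wker_cat_eq0 v s1 s2 : wker V v s1 = 0%VS ->
  wker V (move v s1) s2 = 0%VS -> wker V v (s1 ++ s2) = 0%VS.
Proof.
move=> K1 K2; apply/eqP; rewrite -subv0 -K1; apply/subvP => e.
by rewrite mem_wker_cat K2 memv0 mem_wker.
Qed.

(** As all spaces have the same dimension, a surjective map has zero kernel. *)
Lemma one_generated_word (G : set Q) v : one_generated V G ->
  exists w s, [/\ G w, move w s = v & wker V w s = 0%VS].
Proof.
move=> /(_ v)[w [Gw [g]]].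
move: v g; apply: qpath_wpath => s E; exists w, s; split=> //.
have := dim_limg_wmap V_dim w s; rewrite -/(wmap V w s) in E; rewrite E V_dim => D.
by apply/eqP; rewrite -dimv_eq0; have := dim_wker_le V_dim w s; lia.
Qed.

Hypothesis V_fingen : finitely_generated V.
Hypothesis V_nontrivial : nontrivial V.

(** The paths to [v] that induce injective maps have bounded length: if [G] generates
the net, some nonzero map into the source of such a path comes from a vertex [x]
of [G], and since the composite with it is nonzero, the whole path is an
admissible one from [x] to [v]. *)
Lemma size_inj_word v :
  exists B, forall w s, move w s = v -> wker V w s = 0%VS -> (size s <= B)%N.
Proof.
have le u w (g : qpath u w) : limg (qpath_map V g) != 0%VS ->
    forall s, move w s = v -> wker V w s = 0%VS -> (size s <= dist u v)%N.
  move: w g; apply: qpath_wpath => s' s'N s E K0.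
  rewrite (@distE _ _ _ (s' ++ s)) ?size_cat ?leq_addl // ?move_cat //.
  apply: contraR s'N => /(wker_nadm V_linked u) K.
  rewrite -subv0; apply/subvP => _ /memv_imgP[e _ ->].
  by rewrite -K0 -(mem_wker_cat s' s) K memvf.
(* The bound is the sum, rather than the maximum, of the distances from [G]. *)
have [G genG] := V_fingen; exists (\sum_(x <- G) dist x v)%N => w s E K0.
have [m [x [g [xG sumg]]]] := genG w.
have [i gi] : exists i, limg (qpath_map V (g i)) != 0%VS.
  apply: contrapT => no; apply: (V_nontrivial (v := w)); rewrite -sumg big1 // => i _.
  by apply/eqP/negPn/negP => gi; apply: no; exists i.
by rewrite (leq_trans (le _ _ _ gi _ E K0)) // (big_rem (x i)) ?xG //= leq_addr.
Qed.

(** A vertex outside of the minimum set of generators is reached from another vertex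
by a surjective map; going back in this way ends by [size_inj_word]. *)
Lemma min_generators_generate v :
  exists w s, [/\ min_generators V w, move w s = v & wker V w s = 0%VS].
Proof.
have [B leB] := size_inj_word v.
have longer w s : move w s = v -> wker V w s = 0%VS -> ~ min_generators V w ->
    exists w' s', [/\ move w' s' = v, wker V w' s' = 0%VS & (size s < size s')%N].
  move=> E K0 /existsNP[G /not_implyP[genG wG]].
  have [w' [s' [Gw' E' K']]] := one_generated_word w genG.
  exists w', (s' ++ s); split; first by rewrite move_cat E'.
    by apply: wker_cat_eq0; rewrite ?E'.
  rewrite size_cat -[ltnLHS]add0n ltn_add2r.
  by case: s' E' {K'} => //= E'; case: wG; rewrite -E'.
suff gen m w s : (B < size s + m)%N -> move w s = v -> wker V w s = 0%VS ->
    exists w s, [/\ min_generators V w, move w s = v & wker V w s = 0%VS].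
  by apply: (gen B.+1 v [::]) => //; exact: wker_nil.
elim: m w s => [|m IH] w s ltB E K0.
  by have := leB _ _ E K0; rewrite leqNgt -[size s]addn0 ltB.
have [wmin|wN] := pselect (min_generators V w); first by exists w, s.
have [w' [s' [E' K' lt]]] := longer w s E K0 wN.
by apply: (IH w' s') => //; rewrite (leq_trans ltB) // addnS -addSn leq_add2r.
Qed.

End Generation.

(** * The energy and the polytopes *)

Section Tiling.
Set Implicit Arguments.
Unset Strict Implicit.
Unset Printing Implicit Defensive.
Import Order.TTheory GRing.Theory Num.Theory.
Local Open Scope ring_scope.
Variables (R : realType) (k : fieldType) (n : nat) (Q : Zn_quiver n).
Variable (V : representation k Q).
Local Notation T := 'I_n.+1.
Hypotheses (V_linked : linked_net V) (V_exact : exact_net V).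
Variable d : nat.
Hypothesis V_dim : pure_dim V d.
Variables (o : Q) (H : {fset Q}).
Implicit Types (v w : Q) (h u : H) (x s : seq T) (q : {ffun H -> R}).

(** The energy of the vertex [v] for the weight [q] on [H]. *)
Definition energy q v : R :=
  \sum_u q u * (dist v (val u))%:R + (degree V d o v)%:~R.

Lemma energy_step q v x : \sum_u q u = d%:R -> uniq x ->
  energy q (move v x) - energy q v = n.+1%:R *
    (d%:R - (\dim (wker V v x))%:R - \sum_(u : H | all (mem (wd v (val u))) x) q u).
Proof.
move=> qd ux.
have distR (u : H) : (dist (move v x) (val u))%:R = (dist v (val u))%:R - (size x)%:R
    + n.+1%:R - (if all (mem (wd v (val u))) x then n.+1%:R else 0) :> R.
  have [/allP sx|nsx] := boolP (all _ x).
    by rewrite (dist_step_sub ux sx) natrD; ring.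
  by rewrite subr0 addrAC -natrD -(dist_step_nsub ux nsx) natrD addrK.
have -> : \sum_(u : H | all (mem (wd v (val u))) x) q u =
    \sum_(u : H) (if all (mem (wd v (val u))) x then q u else 0).
  exact: big_mkcond.
have sumE : \sum_u q u * (dist (move v x) (val u))%:R =
    \sum_u q u * (dist v (val u))%:R + (n.+1%:R - (size x)%:R) * \sum_u q u
    - n.+1%:R * \sum_(u : H) (if all (mem (wd v (val u))) x then q u else 0).
  rewrite !mulr_sumr -big_split -sumrB /=; apply: eq_bigr => u _.
  by rewrite distR; case: ifP => _; ring.
rewrite /energy sumE (degree_move V_linked V_exact V_dim) kersum_uniq // qd.
rewrite !intrD !intrN -!pmulrn !natrM; ring.
Qed.

Lemma mu_polytope_sub_simplex h : (mu_polytope V R h `<=` std_simplex R H d)%classic.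
Proof.
move=> q qP; split=> [u|].
  have /andP[+ _] := qP [set u]; rewrite big_set1; apply: le_trans; exact: ler0n.
have := qP [set: H]; rewrite /mu /mu_star finset.setCT big_set0 V_dim => /andP[].
have -> : \sum_u q u = \sum_(u in [set: H]) q u by apply: eq_bigl => u; rewrite inE.
move=> ge le; apply/eqP; rewrite eq_le ge andbT (le_trans le) // ler_nat leq_subr //.
Qed.

Lemma mu_polytope_bound h q x : mu_polytope V R h q -> adm x ->
  \sum_(u : H | all (mem (wd (val h) (val u))) x) q u
    <= d%:R - (\dim (wker V (val h) x))%:R.
Proof.
move=> qP xA; pose I := [set u : H | all (mem (wd (val h) (val u))) x].
have -> : \sum_(u : H | all (mem (wd (val h) (val u))) x) q u = \sum_(u in I) q u.
  by apply: eq_bigl => u; rewrite inE.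
have /andP[_ le] := qP I; apply: le_trans le _.
rewrite /mu_star V_dim -natrB ?dim_wker_le // ler_nat leq_sub2l //.
apply: dimvS; apply/subv_bigcapP => u; rewrite inE => /allP xu.
rewrite -(wker_phi V_linked (wd_adm (val h) (val u)) (move_wd _ _)).
rewrite (wker_undup V_linked V_exact _ xA).
have [|y p _] := @sub_perm _ (undup x) (wd (val h) (val u)) (undup_uniq x).
  by move=> a; rewrite mem_undup => /xu.
by rewrite (wker_perm V_linked _ p) wker_catl.
Qed.

(** The inequalities indexed by sets of types imply those indexed by subsets of [H];
[mu_polytope_bound] is the converse. *)
Lemma mu_polytope_intro h q : std_simplex R H d q ->
  (forall x, uniq x -> \sum_(u : H | all (mem (wd (val h) (val u))) x) q u
     <= d%:R - (\dim (wker V (val h) x))%:R) ->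
  mu_polytope V R h q.
Proof.
move=> [q0 qd] qx.
have up (I : {set H}) : \sum_(u in I) q u <= (mu_star V h I)%:R.
  (* The types that occur on the way from [h] to every vertex of [I]. *)
  pose x := [seq a <- enum 'I_n.+1 |
      all (fun w => a \in wd (val h) w) [seq val u | u <- enum I]].
  have K : (\dim (\bigcap_(u in I) lker (phi V (val h) (val u))) <= \dim (wker V (val h) x))%N.
    apply: dimvS; have := bigcap_wker V_linked V_exact (val h) [seq val u | u <- enum I].
    by rewrite big_map big_enum.
  rewrite /mu_star V_dim natrB; last by rewrite (leq_trans K) ?dim_wker_le.
  apply: le_trans (le_trans (qx x _) _); last by rewrite lerD2l lerN2 ler_nat.
    rewrite [leRHS](bigID (fun u => u \in I)) /=.
    rewrite (eq_bigl (fun u : H => all (mem (wd (val h) (val u))) x && (u \in I))).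
      by rewrite lerDl sumr_ge0.
    move=> u; case: (boolP (u \in I)) => uI; rewrite ?andbF // andbT.
    apply/esym/allP => a; rewrite mem_filter => /andP[/allP + _]; apply.
    by apply: map_f; rewrite mem_enum.
  exact: filter_uniq (enum_uniq _).
move=> I; rewrite up andbT; have := up (~: I).
have : \sum_(u in I) q u + \sum_(u in ~: I) q u = d%:R.
  rewrite -qd [RHS](bigID (fun u => u \in I)) /=; congr +%R.
  by apply: eq_bigl => u; rewrite inE.
rewrite /mu_star /mu V_dim natrB; last by rewrite -(V_dim (val h)) dimvS ?subvf.
lra.
Qed.

Lemma mu_polytope_energy_min h q : std_simplex R H d q ->
  (forall w, energy q (val h) <= energy q w) -> mu_polytope V R h q.
Proof.
move=> qS qmin; apply: mu_polytope_intro => // x ux; rewrite -subr_ge0.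
by rewrite -(@pmulr_rge0 _ n.+1%:R) // -energy_step ?subr_ge0 //; case: qS.
Qed.

(** A vertex in [H] is a global minimum of the energy for every weight in its polytope. *)
Lemma energy_min_global h q w : mu_polytope V R h q ->
  energy q (val h) <= energy q w.
Proof.
move=> qP; have [q0 qd] := mu_polytope_sub_simplex qP.
rewrite -(move_wd (val h) w); move: (wd_adm (val h) w); move: (wd (val h) w) => s.
have [m] := ubnP (size s); elim: m s => // m IH s lt sA.
(* The support of [s] is appended last, after the repeated letters [y]. *)
have [y p sy] := perm_undup_cat s; rewrite perm_sym perm_catC perm_sym in p.
have [s0|s0] := eqVneq s [::]; first by rewrite s0.
have lty : (size y < m)%N.
  rewrite -ltnS; apply: leq_trans lt; rewrite ltnS (perm_size p) size_cat -addn1 leq_add2l.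
  rewrite lt0n size_eq0; apply: contra s0 => /eqP s0; apply/eqP/undup_nil/s0.
apply: le_trans (IH y lty (adm_sub sy sA)) _.
rewrite (move_perm _ p) move_cat -subr_ge0 energy_step ?undup_uniq //.
rewrite mulr_ge0 // subr_ge0.
have xA : adm (undup s) by apply: adm_sub sA => a; rewrite mem_undup.
have K : (\dim (wker V (move (val h) y) (undup s)) <= \dim (wker V (val h) (undup s)))%N.
  rewrite -(wker_undup V_linked V_exact (val h) sA) (wker_perm V_linked (val h) p).
  exact: (dim_wker_move V_dim (val h) y (undup s)).
apply: le_trans (le_trans (mu_polytope_bound qP xA) _); last by rewrite lerD2l lerN2 ler_nat.
rewrite [leLHS]big_mkcond [leRHS]big_mkcond /=; apply: ler_sum => u _.
case: ifP => [/allP su|_]; last by case: ifP.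
case: ifP => // /negP[]; apply/allP => a ax /=.
have sub : {subset y ++ wd (move (val h) y) (val u) <= wd (move (val h) y) (val u)}.
  by move=> b; rewrite mem_cat => /orP[/sy|//]; rewrite -mem_undup => /su.
have A := adm_sub sub (wd_adm _ _).
by rewrite -(perm_mem (perm_wd A _)) ?move_cat ?move_wd // mem_cat [X in _ || X](su a ax) orbT.
Qed.

(** The energy does not decrease along a path that induces an injective map. *)
Lemma energy_le_inj q w s : std_simplex R H d q -> wker V w s = 0%VS ->
  energy q w <= energy q (move w s).
Proof.
move=> [q0 qd] K0; rewrite /energy (degree_move V_linked V_exact V_dim).
rewrite (kersum0 V_dim K0) muln0 subr0 intrD -pmulrn natrM -qd addrA addrAC lerD2r.
rewrite mulr_suml -big_split /=; apply: ler_sum => u _.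
rewrite -mulrDr ler_wpM2l // -natrD ler_nat.
by have := dist_le w (s ++ wd (move w s) (val u)); rewrite move_cat move_wd size_cat addnC.
Qed.

Lemma mu_polytope_face h u :
  is_face (mu_polytope V R h) (mu_polytope V R h `&` mu_polytope V R u)%classic.
Proof.
(* The inequality says that the energy of [u] is at least that of [h]. *)
exists [ffun w : H => (dist (val h) (val w))%:R - (dist (val u) (val w))%:R].
exists ((degree V d o (val u))%:~R - (degree V d o (val h))%:~R).
have E q : \sum_w [ffun w : H => (dist (val h) (val w))%:R - (dist (val u) (val w))%:R] w * q w
    = \sum_w q w * (dist (val h) (val w))%:R - \sum_w q w * (dist (val u) (val w))%:R :> R.
  by rewrite -sumrB; apply: eq_bigr => w _; rewrite ffunE; ring.
split=> [q /(energy_min_global (val u))|].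
  by rewrite E /energy; lra.
apply/seteqP; split=> q /= [qh].
  move=> qu; split=> //; rewrite E; move: (energy_min_global (val u) qh).
  by move: (energy_min_global (val h) qu); rewrite /energy; lra.
rewrite E => Eq; split=> //; apply: mu_polytope_energy_min; first exact: mu_polytope_sub_simplex qh.
move=> w; apply: le_trans (energy_min_global w qh).
by move: Eq; rewrite /energy; lra.
Qed.

Lemma bigcup_mu_polytope :
  (forall v, exists (h : H) s, move (val h) s = v /\ wker V (val h) s = 0%VS) ->
  (\bigcup_h mu_polytope V R h)%classic = std_simplex R H d.
Proof.
move=> gen; apply/seteqP; split=> q; first by case=> h _ /mu_polytope_sub_simplex.
move=> qS; have [h0 _] := gen o.
pose h := [arg min_(h < h0) energy q (val h)]%O; exists h => //.
apply: mu_polytope_energy_min => // v; have [h' [s [<- K0]]] := gen v.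
apply: le_trans (energy_le_inj qS K0).
by rewrite /h; case: arg_minP => // i _; apply.
Qed.

End Tiling.

(** * The tiling *)

Theorem theorem4p2 (R : realType) (k : fieldType) (n r : nat)
  (Q : Zn_quiver n) (V : representation k Q)
  (V_linked : linked_net V) (V_exact : exact_net V)
  (V_fingen : finitely_generated V) (V_nontrivial : nontrivial V)
  (V_dim : pure_dim V r.+1)
  (H : {fset Q}) (H_min : [set` H]%classic = min_generators V) :
  polyhedral_tiling (fun v : H => mu_polytope V R v) (std_simplex R H r.+1) /\
  (\bigcup_(v in [set: H]) mu_polytope V R v)%classic = std_simplex R H r.+1.
Proof.
have [o _] := arrow_type_surj (quiver_of Q) ord0.
have gen v : exists (h : H) s, move (val h) s = v /\ wker V (val h) s = 0%VS.
  have [w [s [wmin E K0]]] := min_generators_generate V_linked V_dim V_fingen V_nontrivial v.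
  have wH : w \in H by move: wmin; rewrite -H_min.
  by exists [` wH]%fset, s.
have cover := bigcup_mu_polytope R V_linked V_exact V_dim o gen.
split=> //; split=> // h u; right; split.
  exact: (mu_polytope_face R V_linked V_exact V_dim o).
rewrite setIC; exact: (mu_polytope_face R V_linked V_exact V_dim o).
Qed.
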